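(* Let $n\ge 2$ and fix $A\in\mathbb{R}^{n\times n}$. Let $A\boxplus A$ denote the bialternate sum of $A$ with itself, and let $A^{[2]}$ denote the second additive compound of $A$. Then $$A\boxplus A=A^{[2]}.$$
   Context: Bialternate sum. For $A=(a_{ij})\in\mathbb{R}^{n\times n}$, the bialternate sum of $A$ with itself, denoted here $A\boxplus A$, is the $\frac{n(n-1)}{2}\times\frac{n(n-1)}{2}$ matrix defined as follows. Let $L(n)$ be the ordered list of pairs $$(2,1),(3,1),\dots,(n,1),(3,2),(4,2),\dots,(n,2),\dots,(n-1,n-2),(n,n-2),(n,n-1).$$ For $x,y\in\{1,\dots,\frac{n(n-1)}{2}\}$, let $(p,q)$ be the pair in position $x$ and $(r,s)$ the pair in position $y$ of $L(n)$. Then entry $(x,y)$ of $A\boxplus A$ is $$a_{pr}\delta_{qs}+a_{qs}\delta_{pr}-a_{ps}\delta_{qr}-a_{qr}\delta_{ps},$$ where $\delta_{ij}=1$ if $i=j$ and $0$ otherwise. Second additive compound. For $B\in\mathbb{R}^{n\times n}$, the second multiplicative compound $B^{(2)}$ is the $\binom{n}{2}\times\binom{n}{2}$ matrix of all $2$-minors of $B$, with rows and columns indexed by the pairs $(i_1,i_2)$, $1\le i_1<i_2\le n$, in lexicographic order (the entry in row $(i_1,i_2)$ and column $(j_1,j_2)$ is $b_{i_1j_1}b_{i_2j_2}-b_{i_1j_2}b_{i_2j_1}$). The second additive compound is $A^{[2]}:=\frac{d}{d\varepsilon}(I_n+\varepsilon A)^{(2)}\big|_{\varepsilon=0}$. 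*)

(* Defs.v *)
(* MathComp / MathComp-Analysis *)
From mathcomp Require Import all_boot all_order all_algebra.
From mathcomp Require Import all_classical all_reals all_analysis.

Set Implicit Arguments.
Unset Strict Implicit.
Unset Printing Implicit Defensive.

Import Order.TTheory GRing.Theory Num.Theory.
Import numFieldNormedType.Exports.

Local Open Scope ring_scope.

(* Indices and list positions are counted from 0, so that the pair (2,1) of
   the 1-based convention is (1,0) here and stands at position 0. *)

Definition bialternate_list (n : nat) : seq ('I_n * 'I_n) :=
  [seq (p, q) | q : 'I_n <- enum 'I_n,
                p : 'I_n <- [seq p : 'I_n <- enum 'I_n | (q < p)%N]].

Definition lex_list (n : nat) : seq ('I_n * 'I_n) :=
  [seq (i, j) | i : 'I_n <- enum 'I_n,
                j : 'I_n <- [seq j : 'I_n <- enum 'I_n | (i < j)%N]].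

Lemma sum_size_gt_ord (n : nat) :
  sumn [seq size [seq j : 'I_n <- enum 'I_n | (i < j)%N] | i : 'I_n <- enum 'I_n]
  = 'C(n, 2).
Proof.
rewrite -bin2_sum big_mkord sumnE big_map big_enum /=.
rewrite (reindex_inj rev_ord_inj) /=; apply: eq_bigr => i _.
rewrite size_filter -(count_map val (fun k => n - i.+1 < k)%N).
rewrite val_enum_ord -size_filter.
have -> : iota 0 n = (iota 0 (n - i)%N ++ iota (n - i)%N i)%SEQ.
  by rewrite -{2}[(n - i)%N]add0n -iotaD subnK // ltnW.
rewrite filter_cat size_cat.
rewrite (_ : seq.filter _ (iota 0 _) = [::]); last first.
  apply/eqP; rewrite -[_ == _]negbK -has_filter; apply/hasPn => k.
  by rewrite mem_iota add0n => /andP[_]; rewrite -leqNgt subnS; case: (n - i)%N.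
rewrite (_ : seq.filter _ (iota _ _) = iota (n - i)%N i) ?size_iota //.
apply/all_filterP/allP => k; rewrite mem_iota => /andP[+ _].
by apply: leq_trans; rewrite subnSK.
Qed.

Lemma size_bialternate_list (n : nat) :
  size (bialternate_list n) == (n * n.-1)./2.
Proof. by rewrite size_allpairs_dep sum_size_gt_ord bin2. Qed.

Lemma size_lex_list (n : nat) : size (lex_list n) == 'C(n, 2).
Proof. by rewrite size_allpairs_dep sum_size_gt_ord. Qed.

Definition bialternate_tuple (n : nat) : (n * n.-1)./2.-tuple ('I_n * 'I_n) :=
  Tuple (size_bialternate_list n).

Definition lex_tuple (n : nat) : 'C(n, 2).-tuple ('I_n * 'I_n) :=
  Tuple (size_lex_list n).

Definition bialternate_sum (R : realType) (n : nat) (A : 'M[R]_n) :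
    'M[R]_((n * n.-1)./2) :=
  \matrix_(x, y)
    let: (p, q) := tnth (bialternate_tuple n) x in
    let: (r, s) := tnth (bialternate_tuple n) y in
    A p r * (q == s)%:R + A q s * (p == r)%:R
    - A p s * (q == r)%:R - A q r * (p == s)%:R.

Definition multiplicative_compound2 (R : realType) (n : nat) (B : 'M[R]_n) :
    'M[R]_'C(n, 2) :=
  \matrix_(x, y)
    let: (i1, i2) := tnth (lex_tuple n) x in
    let: (j1, j2) := tnth (lex_tuple n) y in
    B i1 j1 * B i2 j2 - B i1 j2 * B i2 j1.

(* [derive1] is total; the function differentiated here is differentiable by
   [derivable_multiplicative_compound2] below. *)
Definition additive_compound2 (R : realType) (n : nat) (A : 'M[R]_n) :
    'M[R]_'C(n, 2) :=
  derive1 (fun e : R => multiplicative_compound2 (1%:M + e *: A)) 0.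

Lemma derivable_multiplicative_compound2 (R : realType) (n : nat)
    (A : 'M[R]_n) :
  derivable (fun e : R => multiplicative_compound2 (1%:M + e *: A)) 0 1.
Proof.
have dE (i j : 'I_n) : derivable (fun e : R => (1%:M + e *: A) i j) 0 1.
  rewrite (_ : (fun _ => _) = (fun e : R => (1%:M : 'M[R]_n) i j + e * A i j)).
    by apply: derivableD => //; apply: derivableM.
  by apply/funext => e; rewrite !mxE.
apply/derivable_mxP => x y.
rewrite (_ : (fun _ => _) = (fun e : R =>
  let: (i1, i2) := tnth (lex_tuple n) x in
  let: (j1, j2) := tnth (lex_tuple n) y in
  (1%:M + e *: A) i1 j1 * (1%:M + e *: A) i2 j2
  - (1%:M + e *: A) i1 j2 * (1%:M + e *: A) i2 j1)); last first.
  by apply/funext => e; rewrite mxE.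
case: (tnth _ x) => i1 i2; case: (tnth _ y) => j1 j2.
by apply: derivableB; apply: derivableM; apply: dE.
Qed.

(* Main.v *)
(* L(n) is the lexicographic list with every pair (i, j) swapped, so position
   by position both matrices are indexed by the same pairs, and the entries
   agree by the product rule for the 2-minors of 1 + e A at e = 0. *)
Require Import Defs.
From mathcomp Require Import all_boot all_order all_algebra.
From mathcomp Require Import all_classical all_reals all_analysis.
From mathcomp Require Import ring.

Import GRing.Theory numFieldNormedType.Exports.

Local Open Scope ring_scope.

Lemma bialternate_listE (n : nat) :
  bialternate_list n = [seq (ij.2, ij.1) | ij <- lex_list n].
Proof. by rewrite map_allpairs. Qed.

(** The two tuple lengths agree only through [bin2], so positions are transported by [cast_ord], in
    the form that [castmxE] produces. *)
Lemma tnth_bialternate_tuple (n : nat) (z : 'I_(n * n.-1)./2) :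
  let ij := tnth (lex_tuple n) (cast_ord (esym (bin2 n)) z) in
  tnth (bialternate_tuple n) z = (ij.2, ij.1).
Proof.
(* For arbitrary [n] there is no canonical pair, so [ij] supplies the default of [nth]. *)
move=> ij; rewrite (tnth_nth (ij.2, ij.1)) /= bialternate_listE.
rewrite (nth_map ij); last by rewrite (eqP (size_lex_list n)) bin2.
by have /= <- := tnth_nth ij (lex_tuple n) (cast_ord (esym (bin2 n)) z).
Qed.

Lemma derive1_mx (R : realType) (m k : nat) (M : R -> 'M[R]_(m, k)) (t : R)
    (i : 'I_m) (j : 'I_k) :
  derivable M t 1 -> derive1 M t i j = derive1 (fun x => M x i j) t.
Proof. by move=> dM; rewrite !derive1E derive_mx // mxE. Qed.

Lemma is_derive_affine_entry (R : realType) (n : nat) (A : 'M[R]_n)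
    (i j : 'I_n) :
  is_derive (0 : R) 1 (fun e : R => (1%:M + e *: A) i j) (A i j).
Proof.
(* As a constant plus a scaled identity, the entry gets its derivative from the [is_derive]
   instances. *)
rewrite (_ : (fun _ => _) =
    cst ((i == j)%:R : R) + (fun e : R => A i j *: e)).
  by apply: is_derive_eq; rewrite add0r /GRing.scale /= mulr1.
by apply/funext => e; rewrite !mxE fctE /= mulrC.
Qed.

Theorem proposition4 (R : realType) (n : nat) (hn : (2 <= n)%N) (A : 'M[R]_n) :
  bialternate_sum A = castmx (bin2 n, bin2 n) (additive_compound2 A).
Proof.
apply/matrixP => x y; rewrite castmxE /additive_compound2.
rewrite derive1_mx; last exact: derivable_multiplicative_compound2.
rewrite mxE !tnth_bialternate_tuple.
rewrite (_ : (fun _ => _) = (fun e : R =>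
  let: (i1, i2) := tnth (lex_tuple n) (cast_ord (esym (bin2 n)) x) in
  let: (j1, j2) := tnth (lex_tuple n) (cast_ord (esym (bin2 n)) y) in
  (1%:M + e *: A) i1 j1 * (1%:M + e *: A) i2 j2
  - (1%:M + e *: A) i1 j2 * (1%:M + e *: A) i2 j1)); last first.
  by apply/funext => e; rewrite mxE.
case: (tnth _ _) => i1 i2; case: (tnth _ _) => j1 j2 /=.
have dA := is_derive_affine_entry R n A.
have /@derive_val dminor := is_deriveB (is_deriveM (dA i1 j1) (dA i2 j2))
  (is_deriveM (dA i1 j2) (dA i2 j1)).
(* At 0 the undifferentiated factors become Kronecker deltas; the resulting four-term formula is
   unchanged when both index pairs are swapped. *)
rewrite derive1E dminor !mxE !mul0r !addr0 /GRing.scale /=.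
ring.
Qed.
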